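(* Let $n\ge2$ and $Q=n+2$ (so $Q\geq 4$). Then for every radial function $u\in C_c^\infty(\mathbb{R}^{n+1} \setminus \{o\})$: (a) (Hardy-Rellich identity) $$\int_{\mathbb{R}^{n+1}}\frac{(\mathcal{L}_G u)^{2}}{|\nabla_G \varrho|^{2}}\,dx\,dt = \frac{Q^2}{4} \int_{\mathbb{R}^{n+1}} \frac{|\nabla_G u|^{2}}{\varrho^2}\,dx\,dt +\int_{\mathbb{R}^{n+1}}\varrho^{2-Q} \left|\nabla_{G}\left(u_\varrho\, \varrho^{\frac{Q-2}{2}}\right)\right|^{2}\,dx\,dt.$$ (b) (Rellich identity) $$\int_{\mathbb{R}^{n+1}}\frac{(\mathcal{L}_G u)^2}{|\nabla_G \varrho|^2}\,dx\,dt=\frac{Q^2(Q-4)^2}{16}\int_{\mathbb{R}^{n+1}} \frac{|u|^2|\nabla_G \varrho|^2}{\varrho^4}\,dx\,dt + \frac{Q^2}{4}\int_{\mathbb{R}^{n+1}}\varrho^{2-Q}\left|\nabla_G\left(u\,\varrho^{\frac{Q-4}{2}}\right)\right|^2\,dx\,dt +\int_{\mathbb{R}^{n+1}} \varrho^{2-Q}\left|\nabla_{G}\left(u_\varrho\, \varrho^{\frac{Q-2}{2}}\right)\right|^{2} \,dx\,dt.$$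
   Context: Grushin space: $n\ge 2$ is an integer and $Q=n+2$ (homogeneous dimension). Points of $\mathbb{R}^{n+1}$ are written $(x,t)$ with $x\in\mathbb{R}^n$, $t\in\mathbb{R}$; $o$ is the origin; all functions are real-valued. The Grushin gradient is $\nabla_G u=(\nabla_x u,\ |x|\partial_t u)$, so $|\nabla_G u|^2=|\nabla_x u|^2+|x|^2(\partial_t u)^2$. The Grushin operator is $\mathcal{L}_G=\Delta_x+|x|^2\partial_t^2$. The homogeneous norm is $\varrho(x,t)=(|x|^4+4t^2)^{1/4}$; it satisfies $|\nabla_G\varrho|^2=|x|^2/\varrho^2$ away from $o$. A function is radial if it depends only on $\varrho(x,t)$. The suffix $\varrho$ denotes the radial derivative: $u_\varrho=\partial_\varrho u=\frac1\varrho\left(\sum_{j=1}^n x_j\partial_{x_j}u+2t\,\partial_t u\right)$. *)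

(* Defs.v *)
From HB Require Import structures.
From mathcomp Require Import all_boot all_order all_algebra.
From mathcomp Require Import all_classical all_reals all_analysis.

Set Implicit Arguments.
Unset Strict Implicit.
Unset Printing Implicit Defensive.

Import Order.TTheory GRing.Theory Num.Theory.
Import numFieldNormedType.Exports.

Local Open Scope classical_set_scope.
Local Open Scope ring_scope.

Section lebesgue_cons.
Local Open Scope ereal_scope.
Variables (R : realType) (n : nat).
Variable mu :
  {sigma_finite_measure set (n.-tuple (measurableTypeR R)) -> \bar R}.

Definition cons_pair (p : measurableTypeR R * n.-tuple (measurableTypeR R)) :
  n.+1.-tuple (measurableTypeR R) := [tuple of p.1 :: p.2].

Lemma measurable_cons_pair : measurable_fun [set: _] cons_pair.
Proof. by apply: measurable_cons. Qed.

HB.instance Definition _ :=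
  isMeasurableFun.Build _ _ _ _ cons_pair measurable_cons_pair.

Definition lebesgue_cons : set (n.+1.-tuple (measurableTypeR R)) -> \bar R :=
  pushforward (lebesgue_measure \x mu) cons_pair.

Let lebesgue_cons0 : lebesgue_cons set0 = 0.
Proof. exact: measure0. Qed.

Let lebesgue_cons_ge0 A : 0 <= lebesgue_cons A.
Proof. exact: measure_ge0. Qed.

Let lebesgue_cons_sigma_additive : semi_sigma_additive lebesgue_cons.
Proof. exact: measure_semi_sigma_additive. Qed.

HB.instance Definition _ := isMeasure.Build _ _ _ lebesgue_cons
  lebesgue_cons0 lebesgue_cons_ge0 lebesgue_cons_sigma_additive.

Let lebesgue_cons_sigma_finite : sigma_finite setT lebesgue_cons.
Proof.
have /sigma_finiteP[F [FT ndF Foo]] := sigma_finiteT (@lebesgue_measure R).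
have /sigma_finiteP[G [GT ndG Goo]] := sigma_finiteT mu.
exists (fun k => [set t | F k (tnth t ord0) /\ G k [tuple of behead t]]).
  apply/esym; rewrite -subTset => t _.
  have [i _ Fi] : (\bigcup_k F k) (tnth t ord0) by rewrite -FT.
  have [j _ Gj] : (\bigcup_k G k) [tuple of behead t] by rewrite -GT.
  exists (maxn i j) => //; split.
    by move: Fi; exact/subsetPset/ndF/leq_maxl.
  by move: Gj; exact/subsetPset/ndG/leq_maxr.
move=> k; have [mF Fk] := Foo k; have [mG Gk] := Goo k; split.
  apply: measurableI.
    by rewrite -[X in measurable X]setTI; exact: measurable_tnth.
  rewrite -[X in measurable X]setTI.
  exact: (@measurable_behead _ (measurableTypeR R) n).
rewrite /lebesgue_cons /pushforward (_ : _ @^-1` _ = F k `*` G k); last first.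
  apply/seteqP; split => -[x v] /= -[Fx Gv]; split => //.
    by rewrite (_ : v = [tuple of behead (cons_pair (x, v))])//; exact: val_inj.
  by rewrite (_ : [tuple of behead (cons_pair (x, v))] = v)//; exact: val_inj.
by rewrite product_measure1E// lte_mul_pinfty// ge0_fin_numE.
Qed.

HB.instance Definition _ := Measure_isSigmaFinite.Build _ _ _ lebesgue_cons
  lebesgue_cons_sigma_finite.

End lebesgue_cons.

(* Lebesgue measure on R^n, as the n-fold product of one-dimensional Lebesgue
   measures; R^0 carries the unit mass. *)
Fixpoint lebesgue_tuple (R : realType) (n : nat) :
    {sigma_finite_measure set (n.-tuple (measurableTypeR R)) -> \bar R} :=
  match n with
  | 0%N => \d_ ([tuple] : 0.-tuple (measurableTypeR R))
  | m.+1 => lebesgue_cons (lebesgue_tuple R m)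
  end.

(* A point (x, t) of R^(n+1) is an element of 'rV[R]_n * R, which carries the
   topology needed for derivatives and compactness; integrals are taken over
   tuples, which carry the product sigma-algebra. *)
Definition integral_dxdt (R : realType) (n : nat) (f : 'rV[R]_n * R -> R) :
    \bar R :=
  (\int[lebesgue_tuple R n \x @lebesgue_measure R]_p
     (f (\row_(i < n) tnth p.1 i, p.2))%:E)%E.

Section grushin.
Variables (R : realType) (n : nat).
Local Notation point := ('rV[R]_n * R)%type.
Implicit Types (u : point -> R) (z : point).

(* The Euclidean norm of R^n; the library norm of 'rV[R]_n is the sup norm. *)
Definition enorm (x : 'rV[R]_n) : R := Num.sqrt (\sum_(i < n) x 0 i ^+ 2).

(* Some i is the direction of x_i and None the direction of t. *)
Definition direction (k : option 'I_n) : point :=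
  if k is Some i then (delta_mx 0 i, 0) else (0, 1).

Definition partial (k : option 'I_n) u z : R := 'D_(direction k) u z.

Definition pdx (i : 'I_n) : (point -> R) -> point -> R := partial (Some i).

Definition pdt : (point -> R) -> point -> R := partial None.

Definition iter_partial (s : seq (option 'I_n)) u : point -> R :=
  foldr partial u s.

Definition smooth u : Prop := forall s : seq (option 'I_n),
  continuous (iter_partial s u) /\
  forall k z, derivable (iter_partial s u) z (direction k).

(* C_c^oo(R^(n+1) \ {o}); such functions are extended by 0 at the origin. *)
Definition Ccinfty_off_origin u : Prop :=
  [/\ smooth u,
      compact (closure [set z | u z != 0]) &
      ~ closure [set z | u z != 0] 0].

Definition grushin_grad u z : 'rV[R]_n * R :=
  (\row_(i < n) pdx i u z, enorm z.1 * pdt u z).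

(* The squared Euclidean length of a vector of R^n x R. *)
Definition sqlen (w : 'rV[R]_n * R) : R :=
  \sum_(i < n) w.1 0 i ^+ 2 + w.2 ^+ 2.

Definition grushin_op u z : R :=
  \sum_(i < n) pdx i (pdx i u) z + enorm z.1 ^+ 2 * pdt (pdt u) z.

Definition rho z : R := (enorm z.1 ^+ 4 + 4 * z.2 ^+ 2) `^ (1 / 4).

Definition radial u : Prop := exists f : R -> R, forall z, u z = f (rho z).

Definition radial_deriv u z : R :=
  1 / rho z * (\sum_(i < n) z.1 0 i * pdx i u z + 2 * z.2 * pdt u z).

End grushin.

Arguments rho {R n} z.

(* Main.v *)
(* In the variable p = rho^4 = |x|^4 + 4 t^2, a polynomial, a radial u supported
   away from the origin is f(p) with f twice continuously differentiable on R
   and vanishing outside some [a, b], a > 0.  Every integrand of the theorem then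
   has the form |x|^2 p^(-3/2) phi(p) with phi polynomial in p, f, f', f''.
   With Q = n + 2, the differences of the two sides are of the form
   |x|^2 (4 p m'(p) + (n + 4) m(p)), the divergence of |x|^2 m(p) (x, 2 t), whose
   integral vanishes by Fubini and the fundamental theorem of calculus in each
   coordinate.  The identity (a) uses m = 8 Q p^(1/2) f'^2, and (b) adds Q^2 / 4
   times the case m = - (Q - 4) / 2 p^(-3/2) f^2. *)

Require Import Defs.
From HB Require Import structures.
From mathcomp Require Import all_boot all_order all_algebra.
From mathcomp Require Import all_classical all_reals all_analysis.
From mathcomp Require Import ring lra measurable_realfun.

Set Implicit Arguments.
Unset Strict Implicit.
Unset Printing Implicit Defensive.

Import Order.TTheory GRing.Theory Num.Theory.
Import numFieldNormedType.Exports.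

Local Open Scope classical_set_scope.
Local Open Scope ring_scope.

(** * Integration over R^n by slices *)

Section boxed.
Context d (T : measurableType d) (R : realType).
Implicit Types (A : set T) (f g : T -> R).

(** On a set of finite measure this class consists of integrable functions. It is stable under sums
    and under the products used below, so Fubini and linearity never require a separate
    integrability proof. *)
Definition boxed A f : Prop :=
  [/\ measurable_fun setT f,
      exists M, forall x, `|f x| <= M &
      forall x, ~ A x -> f x = 0].

Lemma boxed_integrable (mu : {measure set T -> \bar R}) A f :
  measurable A -> (mu A < +oo)%E -> boxed A f ->
  mu.-integrable setT (EFin \o f).
Proof.
move=> mA Aoo [mf [M fM] f0].
rewrite (_ : EFin \o f = (EFin \o f) \_ A); last first.
  apply/funext => x; rewrite /patch; case: ifPn => // /negP.
  by rewrite inE => /f0 /= ->.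
apply/integrable_restrict => //; rewrite setTI.
apply: measurable_bounded_integrable => //; first exact: measurable_funTS.
exists M; split; first exact: num_real.
by move=> N MN x _; exact: le_trans (fM x) (ltW MN).
Qed.

Lemma boxedD A f g : boxed A f -> boxed A g -> boxed A (fun x => f x + g x).
Proof.
move=> [mf [M fM] f0] [mg [N gN] g0]; split.
- exact: measurable_funD.
- by exists (M + N) => x; rewrite (le_trans (ler_normD _ _))// lerD.
- by move=> x Ax; rewrite f0// g0// addr0.
Qed.

(** The bound on [g] is asked on [A] alone, which admits coordinates and other functions unbounded
    on the whole space. *)
Lemma boxedM A f g : measurable_fun setT g ->
  (exists M, forall x, A x -> `|g x| <= M) ->
  boxed A f -> boxed A (fun x => g x * f x).
Proof.
move=> mg [N gN] [mf [M fM] f0]; split.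
- exact: measurable_funM.
(* When [A] is empty [N] may be negative, hence its absolute value. *)
- exists (`|N| * M) => x; have M0 : 0 <= M by apply: le_trans (fM x).
  have [Ax|Ax] := pselect (A x); last by rewrite f0// mulr0 normr0 mulr_ge0.
  by rewrite normrM ler_pM// (le_trans (gN _ Ax))// ler_norm.
- by move=> x /f0 ->; rewrite mulr0.
Qed.

Lemma boxed_sum A (I : Type) (s : seq I) (F : I -> T -> R) :
  (forall i, boxed A (F i)) -> boxed A (fun x => \sum_(i <- s) F i x).
Proof.
move=> bF; elim: s => [|i s IHs].
  under eq_fun do rewrite big_nil.
  by split=> //; exists 0 => x; rewrite normr0.
by under eq_fun do rewrite big_cons; exact: boxedD.
Qed.

End boxed.

Section tuple_measure.
Variable R : realType.
Local Notation mR := (measurableTypeR R).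
Local Notation leb := (@lebesgue_measure R).
Implicit Types (n : nat) (B : R).

Definition cube n B : set (n.-tuple mR) :=
  [set v | forall i, `|tnth v i| <= B].
Arguments cube : clear implicits.

Definition segment B : set mR := `[- B, B]%classic.

Lemma segmentP B (y : mR) : segment B y <-> `|y| <= B.
Proof. by rewrite /segment/= in_itv/= -ler_norml. Qed.

Lemma measurable_segment B : measurable (segment B).
Proof. exact: measurable_itv. Qed.


Lemma tnth_cons_pair0 n (p : mR * n.-tuple mR) : tnth (cons_pair p) ord0 = p.1.
Proof. by rewrite (tnth_nth p.1). Qed.

Lemma tnth_cons_pair n (p : mR * n.-tuple mR) i :
  tnth (cons_pair p) (lift ord0 i) = tnth p.2 i.
Proof. by rewrite !(tnth_nth p.1). Qed.

Lemma cube_cons n B (p : mR * n.-tuple mR) :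
  cube n.+1 B (cons_pair p) <-> `|p.1| <= B /\ cube n B p.2.
Proof.
split=> [pB|[p1 p2] i].
  split; first by rewrite -tnth_cons_pair0; exact: pB.
  by move=> i; rewrite -tnth_cons_pair; exact: pB.
by case: (unliftP ord0 i) => [j|] ->;
  [rewrite tnth_cons_pair; exact: p2|rewrite tnth_cons_pair0].
Qed.

Lemma measurable_cube n B : measurable (cube n B).
Proof.
rewrite (_ : cube n B =
  \bigcap_(i in [set: 'I_n]) ((fun v => tnth v i) @^-1` `[- B, B])); last first.
  apply/seteqP; split=> v vB.
    by move=> i _; rewrite /= in_itv/= -ler_norml.
  by move=> i; have := vB i I; rewrite /= in_itv/= -ler_norml.
apply: fin_bigcap_measurable; first exact: finite_finset.
move=> i _; rewrite -[X in measurable X]setTI.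
exact: measurable_tnth.
Qed.

#[local] Hint Extern 0 (measurable (cube _ _)) => exact: measurable_cube : core.
#[local] Hint Extern 0 (measurable (segment _)) => exact: measurable_segment : core.

Lemma lebesgue_segment B : (leb (segment B) < +oo)%E.
Proof.
by rewrite /segment lebesgue_measure_itv/=; case: ifP => _; rewrite -?EFinB ltry.
Qed.

(** By induction: the preimage of a cube under [cons_pair] is a segment times a cube of one
    dimension less. *)
Lemma lebesgue_tuple_cube n B : (lebesgue_tuple R n (cube n B) < +oo)%E.
Proof.
elim: n => [|n IHn] /=.
  by rewrite diracE; case: (_ \in _); rewrite ltry.
rewrite /lebesgue_cons /pushforward.
rewrite (_ : _ @^-1` _ = segment B `*` cube n B); last first.
  apply/seteqP; split=> p; first by move=> /cube_cons[/segmentP].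
  by move=> [/segmentP p1 p2]; apply/cube_cons.
rewrite product_measure1E//.
by rewrite lte_mul_pinfty// ?lebesgue_segment// ge0_fin_numE// lebesgue_segment.
Qed.

Definition tset n (i : 'I_n) (y : mR) (v : n.-tuple mR) : n.-tuple mR :=
  [tuple if j == i then y else tnth v j | j < n].

Lemma boxed_slicel d1 d2 (T1 : measurableType d1) (T2 : measurableType d2)
    (A1 : set T1) (A2 : set T2) (f : T1 * T2 -> R) x :
  boxed (A1 `*` A2) f -> boxed A2 (fun y => f (x, y)).
Proof.
move=> [mf [M fM] f0]; split.
- exact: measurableT_comp.
- by exists M.
- by move=> y Ay; apply: f0 => -[].
Qed.

Lemma boxed_slicer d1 d2 (T1 : measurableType d1) (T2 : measurableType d2)
    (A1 : set T1) (A2 : set T2) (f : T1 * T2 -> R) y :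
  boxed (A1 `*` A2) f -> boxed A1 (fun x => f (x, y)).
Proof.
move=> [mf [M fM] f0]; split.
- exact: measurableT_comp.
- by exists M.
- by move=> x Ax; apply: f0 => -[].
Qed.

(** Fubini with the [i]-th coordinate integrated before the coordinates preceding it. The induction
    on [n] peels off the head coordinate until [i] is the head. *)
Lemma integral_slice_eq0 n B (i : 'I_n) (f : n.-tuple mR -> R) :
  boxed (cube n B) f ->
  (forall v, \int[leb]_y (f (tset i y v))%:E = 0)%E ->
  (\int[lebesgue_tuple R n]_v (f v)%:E = 0)%E.
Proof.
elim: n => [|n IHn] in i f *; first by case: i.
move=> bf f0 /=.
have [mf [M fM] f0B] := bf.
pose g := f \o @cons_pair R n.
have bg : boxed (segment B `*` cube n B) g.
  split; first exact: (measurableT_comp mf (@measurable_cons_pair R n)).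
  - by exists M => x; exact: fM.
  - by move=> p pB; apply: f0B => /cube_cons[/segmentP ? ?]; apply: pB.
have ig : (leb \x lebesgue_tuple R n)%E.-integrable setT (EFin \o g).
  have Aoo : ((leb \x lebesgue_tuple R n) (segment B `*` cube n B) < +oo)%E.
    rewrite product_measure1E// lte_mul_pinfty ?lebesgue_tuple_cube//.
    by rewrite ge0_fin_numE// lebesgue_segment.
  have mA : measurable (segment B `*` cube n B) by exact: measurableX.
  exact: (@boxed_integrable _ _ _ (leb \x lebesgue_tuple R n)%E _ _ mA Aoo bg).
have mEf : measurable_fun setT (EFin \o f) by exact/measurable_EFinP.
rewrite [LHS](integral_pushforward (@measurable_cons_pair R n) mEf ig measurableT).
rewrite preimage_setT.
case: (unliftP ord0 i) => [j|] ij; last first.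
  (* Here [i] is the head and is integrated first. The 0 in [cons_pair (0, v)] is a placeholder that
     [tset] overwrites. *)
  rewrite -(integral21_prod_meas1 ig).
  apply: integral0_eq => v _; rewrite /fubini_G /= -[RHS](f0 (cons_pair (0, v))).
  apply: eq_integral => y _; congr (f _)%:E.
  apply: eq_from_tnth => k; rewrite tnth_mktuple ij.
  by case: (unliftP ord0 k) => [l|] ->; rewrite /g ?eqxx ?tnth_cons_pair0 ?tnth_cons_pair.
(* Here [i] lies in the tail: for each fixed head the inner integral vanishes by induction. *)
rewrite -(integral12_prod_meas1 ig).
apply: integral0_eq => x _; rewrite /fubini_F /=.
apply: (IHn j (fun v => g (x, v))); first exact: boxed_slicel bg.
move=> v; rewrite -[RHS](f0 (cons_pair (x, v))).
apply: eq_integral => y _; congr (f _)%:E.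
apply: eq_from_tnth => k; rewrite tnth_mktuple ij.
case: (unliftP ord0 k) => [l|] ->; rewrite ?tnth_cons_pair0 ?tnth_cons_pair//.
by rewrite tnth_mktuple (inj_eq lift_inj).
Qed.

End tuple_measure.
Arguments cube : clear implicits.

(** * The fundamental theorem of calculus for compactly supported primitives *)

Section line.
Variable R : realType.
Implicit Types (F f : R -> R).

Lemma is_derive_continuous F f : (forall y : R, is_derive y 1 F (f y)) -> continuous F.
Proof.
move=> dF y; apply/differentiable_continuous/derivable1_diffP.
exact: @ex_derive _ _ _ _ _ _ _ (dF y).
Qed.

(** Differentiation is local. This carries the support conditions of a profile over to its
    derivatives. *)
Lemma is_derive_eq0 F f (A : set R) (y : R) : open A -> A y -> {in A, forall x, F x = 0} ->
  is_derive y 1 F (f y) -> f y = 0.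
Proof.
move=> oA Ay F0 dF; rewrite -[f y](@derive_val _ _ _ _ _ _ _ dF).
have d0 : is_derive y 1 (cst 0 : R -> R) (0 : R) by exact: is_derive_cst.
have dF0 : is_derive y 1 F (0 : R).
  apply: near_eq_is_derive d0; near=> x; rewrite F0//.
  by apply/mem_set; near: x; exact: open_nbhs_nbhs.
exact: (@derive_val _ _ _ _ _ _ _ dF0).
Unshelve. all: by end_near. Qed.

Lemma integral_derive_eq0 F f (B : R) : (forall y : R, is_derive y 1 F (f y)) ->
  continuous f -> (forall y, B < `|y| -> F y = 0) ->
  (\int[@lebesgue_measure R]_y (f y)%:E = 0)%E.
Proof.
(* This choice makes [-C, C] nondegenerate for any sign of [B] and puts both endpoints where [F]
   vanishes. *)
move=> dF cf F0; pose C := `|B| + 1.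
have C0 : 0 < C by rewrite ltr_wpDl.
have BC y : C <= `|y| -> B < `|y|.
  by apply: lt_le_trans; rewrite ltr_pwDr// ler_norm.
have f0 y : C < `|y| -> f y = 0.
  move=> Cy; apply: (is_derive_eq0 (A := [set x | C < `|x|])) (dF y) => //.
    by apply: (open_comp _ (@open_gt _ C)) => x _; exact: norm_continuous.
  by move=> x; rewrite inE/= => /ltW /BC; exact: F0.
rewrite (_ : (fun y => (f y)%:E) = (EFin \o f) \_ `[- C, C]); last first.
  apply/funext => y; rewrite /patch mem_setE in_itv/= -ler_norml.
  by case: leP => // /f0 ->.
rewrite -integral_mkcond (@continuous_FTC2 _ f F).
- by rewrite F0 ?F0 ?subee//; apply: BC; rewrite ?normrN ger0_norm// ltW.
- by rewrite gtrN.
- exact: continuous_subspaceT.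
- split.
  + by move=> y _; exact: @ex_derive _ _ _ _ _ _ _ (dF y).
  + by apply/cvg_at_right_filter/(is_derive_continuous dF).
  + by apply/cvg_at_left_filter/(is_derive_continuous dF).
- by move=> y _; rewrite derive1E (@derive_val _ _ _ _ _ _ _ (dF y)).
Qed.

End line.

(** * Fubini on R^n x R for functions supported in a box *)

Section box.
Variables (R : realType) (n : nat).
Local Notation mR := (measurableTypeR R).
Local Notation leb := (@lebesgue_measure R).
Local Notation T := (n.-tuple mR * mR)%type.
Local Notation mu := (lebesgue_tuple R n \x leb)%E.

Definition box (B : R) : set T := cube R n B `*` segment B.

Lemma boxed_box_integrable B (f : T -> R) :
  boxed (box B) f -> mu.-integrable setT (EFin \o f).
Proof.
have mA : measurable (box B).
  by apply: measurableX; [exact: measurable_cube|exact: measurable_segment].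
have Aoo : (mu (box B) < +oo)%E.
  rewrite /box product_measure1E//; [|exact: measurable_cube|exact: measurable_segment].
  rewrite lte_mul_pinfty ?lebesgue_segment//.
  by rewrite ge0_fin_numE// lebesgue_tuple_cube.
exact: (@boxed_integrable _ _ _ mu _ _ mA Aoo).
Qed.

Lemma integral_slicex_eq0 B (i : 'I_n) (f : T -> R) : boxed (box B) f ->
  (forall v t, \int[leb]_y (f (tset i y v, t))%:E = 0)%E ->
  (\int[mu]_p (f p)%:E = 0)%E.
Proof.
move=> bf f0; rewrite -(integral21_prod_meas1 (boxed_box_integrable bf)).
apply: integral0_eq => t _; rewrite /fubini_G /=.
by apply: (integral_slice_eq0 (f := fun v => f (v, t)) (boxed_slicer _ bf)).
Qed.

Lemma integral_slicet_eq0 B (f : T -> R) : boxed (box B) f ->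
  (forall v, \int[leb]_t (f (v, t))%:E = 0)%E ->
  (\int[mu]_p (f p)%:E = 0)%E.
Proof.
move=> bf f0; rewrite -(integral12_prod_meas1 (boxed_box_integrable bf)).
by apply: integral0_eq => v _; rewrite /fubini_F /=.
Qed.

End box.

(** * The divergence theorem for |x|^2 m(rho^4) (x, 2 t) *)

Section divergence.
Variables (R : realType) (n : nat).
Local Notation mR := (measurableTypeR R).
Local Notation leb := (@lebesgue_measure R).
Local Notation T := (n.-tuple mR * mR)%type.
Local Notation mu := (lebesgue_tuple R n \x leb)%E.

(** [tsq] and [tquartic] are |x|^2 and rho^4 on tuples, where integrals live; [xsq] and [quartic]
    are their counterparts on row vectors, where derivatives live. *)
Definition tsq (v : n.-tuple mR) : R := \sum_(i < n) tnth v i ^+ 2.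
Definition tquartic (p : T) : R := tsq p.1 ^+ 2 + 4 * p.2 ^+ 2.

Lemma tsq_ge0 v : 0 <= tsq v.
Proof. by apply: sumr_ge0 => i _; exact: sqr_ge0. Qed.

Lemma tquartic_ge0 p : 0 <= tquartic p.
Proof. by rewrite addr_ge0 ?sqr_ge0// mulr_ge0 ?sqr_ge0. Qed.

Lemma measurable_tsq : measurable_fun setT tsq.
Proof.
apply: measurable_sum => i; apply: measurable_funX; exact: measurable_tnth.
Qed.

Lemma measurable_tquartic : measurable_fun setT tquartic.
Proof.
apply: measurable_funD; first apply: measurable_funX.
  exact: measurableT_comp measurable_tsq measurable_fst.
by apply: measurable_funM => //; apply: measurable_funX; exact: measurable_snd.
Qed.

Section support.
Variables (b : R) (b_ge0 : 0 <= b).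

(** From |x|^4 <= b follows |x|^2 <= 1 + b, and 4 t^2 <= b gives t^2 <= 1 + b. Since 1 + b >= 1, a
    number whose square is at most 1 + b has absolute value at most 1 + b. *)
Lemma tquartic_box p : tquartic p <= b -> box (1 + b) p /\ tsq p.1 <= 1 + b.
Proof.
move=> pb; have X0 := tsq_ge0 p.1.
have t0 := sqr_ge0 p.2.
have Xb : tsq p.1 <= 1 + b by rewrite /tquartic in pb; nra.
have B2 (x : R) : x ^+ 2 <= 1 + b -> `|x| <= 1 + b.
  move=> xb; have B0 : 0 <= 1 + b by lra.
  rewrite -ler_sqr ?nnegrE// real_normK ?num_real// (le_trans xb)//.
  by rewrite expr2 ler_peMr// lerDl.
split => //; split=> [i|] /=; last apply/segmentP.
  have xX : tnth p.1 i ^+ 2 <= tsq p.1.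
    by rewrite /tsq (bigD1 i)//= lerDl sumr_ge0// => j _; exact: sqr_ge0.
  by apply: B2; rewrite (le_trans xX).
by apply: B2; rewrite /tquartic in pb; have := sqr_ge0 (tsq p.1); nra.
Qed.

(** The values of [tquartic] are nonnegative, so the maximum of |phi| on the compact interval [0, b]
    bounds the composite. *)
Lemma boxed_profile (phi : R -> R) : continuous phi ->
  (forall p, b < p -> phi p = 0) -> boxed (box (1 + b)) (phi \o tquartic).
Proof.
move=> cphi phi0; split.
- apply: (measurableT_comp (continuous_measurable_fun cphi)).
  exact: measurable_tquartic.
- have cn : {within `[0, b], continuous (fun p => `|phi p|)}.
    apply: continuous_subspaceT => p.
    by apply: continuous_comp; [exact: cphi|exact: norm_continuous].
  have [c _ cM] := EVT_max b_ge0 cn; exists `|phi c| => p /=.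
  have [pb|pb] := leP (tquartic p) b; last by rewrite phi0// normr0.
  by apply: cM; rewrite in_itv/= tquartic_ge0.
- move=> p pB /=; apply: phi0; rewrite ltNge; apply/negP => /tquartic_box[].
  by move=> /pB.
Qed.

End support.

Lemma boxed_coord B i (f : T -> R) :
  boxed (box B) f -> boxed (box B) (fun p => tnth p.1 i * f p).
Proof.
apply: boxedM; first exact: measurableT_comp (measurable_tnth i) measurable_fst.
by exists B => p [pB _]; exact: pB.
Qed.

Lemma boxed_time B (f : T -> R) :
  boxed (box B) f -> boxed (box B) (fun p => p.2 * f p).
Proof.
apply: boxedM; first exact: measurable_snd.
by exists B => p [_ /segmentP].
Qed.

Lemma boxedZ B c (f : T -> R) :
  boxed (box B) f -> boxed (box B) (fun p => c * f p).
Proof. by apply: boxedM => //; exists `|c|. Qed.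

Lemma boxed_tsq B (f : T -> R) :
  boxed (box B) f -> boxed (box B) (fun p => tsq p.1 * f p).
Proof.
move=> bf; under eq_fun do rewrite /tsq mulr_suml.
apply: boxed_sum => i; under eq_fun do rewrite expr2 -mulrA.
by do 2!apply: boxed_coord.
Qed.

Lemma tsq_tset i y v :
  tsq (tset i y v) = (y : R) ^+ 2 + \sum_(j < n | j != i) tnth v j ^+ 2.
Proof.
rewrite /tsq (bigD1 i)//= tnth_mktuple eqxx; congr (_ + _).
by apply: eq_bigr => j /negPf ji; rewrite tnth_mktuple ji.
Qed.

Lemma boxed_integralD B (f g : T -> R) : boxed (box B) f -> boxed (box B) g ->
  (\int[mu]_p (f p + g p)%:E =
   \int[mu]_p (f p)%:E + \int[mu]_p (g p)%:E)%E.
Proof.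
move=> /boxed_box_integrable bf /boxed_box_integrable bg.
by under eq_integral do rewrite EFinD; exact: integralD.
Qed.

Lemma boxed_integralZ B c (f : T -> R) : boxed (box B) f ->
  (\int[mu]_p (c * f p)%:E = c%:E * \int[mu]_p (f p)%:E)%E.
Proof.
move=> /boxed_box_integrable bf.
by under eq_integral do rewrite EFinM; exact: integralZl.
Qed.

Lemma boxed_integral_sum_eq0 B (I : Type) (s : seq I) (F : I -> T -> R) :
  (forall i, boxed (box B) (F i)) -> (forall i, \int[mu]_p (F i p)%:E = 0)%E ->
  (\int[mu]_p (\sum_(i <- s) F i p)%R%:E = 0)%E.
Proof.
move=> bF F0; elim: s => [|i s IHs].
  by under eq_integral do rewrite big_nil; exact: integral0.
under eq_integral do rewrite big_cons.
by rewrite (boxed_integralD (bF i) (boxed_sum _ bF)) F0 IHs adde0.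
Qed.

Section profile.
Variables (b : R) (m m1 : R -> R).
Hypotheses (b_ge0 : 0 <= b) (dm : forall p : R, is_derive p 1 m (m1 p)).
Hypotheses (cm1 : continuous m1) (m0 : forall p, b < p -> m p = 0).

Let cm : continuous m. Proof. exact: is_derive_continuous dm. Qed.

Let m10 p : b < p -> m1 p = 0.
Proof.
move=> bp; apply: (is_derive_eq0 (A := [set x | b < x])) (dm p) => //.
by move=> x; rewrite inE; exact: m0.
Qed.

(* d/dx_i (x_i |x|^2 m(rho^4)) *)
Let fluxx (i : 'I_n) (p : T) : R :=
  tsq p.1 * m (tquartic p)
  + 2 * (tnth p.1 i * (tnth p.1 i * m (tquartic p)))
  + 4 * (tsq p.1 * (tsq p.1 * (tnth p.1 i * (tnth p.1 i * m1 (tquartic p))))).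

(* d/dt (2 t |x|^2 m(rho^4)) *)
Let fluxt (p : T) : R :=
  2 * (tsq p.1 * m (tquartic p))
  + 16 * (p.2 * (p.2 * (tsq p.1 * m1 (tquartic p)))).

(** The nested products in [fluxx] are ordered so that each outer factor is removed by one closure
    lemma. *)
Let boxed_fluxx i : boxed (box (1 + b)) (fluxx i).
Proof.
apply: boxedD; first apply: boxedD.
- by apply: boxed_tsq; exact: boxed_profile.
- by apply: boxedZ; do 2!apply: boxed_coord; exact: boxed_profile.
- apply: boxedZ; do 2!apply: boxed_tsq; do 2!apply: boxed_coord.
  exact: boxed_profile.
Qed.

Let boxed_fluxt : boxed (box (1 + b)) fluxt.
Proof.
apply: boxedD.
- by apply: boxedZ; apply: boxed_tsq; exact: boxed_profile.
- by apply: boxedZ; do 2!apply: boxed_time; apply: boxed_tsq; exact: boxed_profile.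
Qed.

Let integral_fluxx (i : 'I_n) : (\int[mu]_p (fluxx i p)%:E = 0)%E.
Proof.
apply: (integral_slicex_eq0 (i := i) (boxed_fluxx i)).
move=> v t; pose c := \sum_(j < n | j != i) tnth v j ^+ 2.
have c0 : 0 <= c by apply: sumr_ge0 => j _; exact: sqr_ge0.
(* This is rho^4 along the line in direction x_i; on that line |x|^2 is y^2 + c. *)
pose q (y : R) : R := (y ^+ 2 + c) ^+ 2 + 4 * (t : R) ^+ 2.
have dq (y : R) : is_derive y 1 q (4 * y * (y ^+ 2 + c)).
  by apply: is_derive_eq; rewrite /GRing.scale/=; ring.
have cq : continuous q by exact: is_derive_continuous dq.
have cmq : continuous (m \o q).
  by move=> y; apply: continuous_comp; [exact: cq|exact: cm].
have cm1q : continuous (m1 \o q).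
  by move=> y; apply: continuous_comp; [exact: cq|exact: cm1].
apply: (integral_derive_eq0 (F := fun y => y * (y ^+ 2 + c) * m (q y)) (B := 1 + b)).
- move=> y; rewrite /fluxx /tquartic /= tsq_tset tnth_mktuple eqxx -/c -/(q y).
  have dmq := is_derive1_comp (dm (q y)) (dq y).
  by apply: is_derive_eq; rewrite /GRing.scale/=; ring.
- under eq_fun do rewrite /fluxx /tquartic /= tsq_tset tnth_mktuple eqxx -/c -/(q _).
  have cy2 : continuous (fun y : R => y ^+ 2 + c).
    by move=> y; apply: cvgD; [exact: exprn_continuous|exact: cvg_cst].
  move=> y; apply: cvgD; first apply: cvgD.
  + by apply: cvgM; [exact: cy2|exact: cmq].
  + by apply: cvgM; [exact: cvg_cst|do 2!(apply: cvgM; [exact: cvg_id|]); exact: cmq].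
  + apply: cvgM; first exact: cvg_cst.
    do 2!(apply: cvgM; first exact: cy2).
    by do 2!(apply: cvgM; first exact: cvg_id); exact: cm1q.
(* Beyond 1 + b one has q(y) >= y^4 > (1 + b)^4 > b, outside the support of [m]. *)
- move=> y By; rewrite m0 ?mulr0//.
  have y2 : (1 + b) ^+ 2 < y ^+ 2.
    by rewrite -(real_normK (num_real y)) ltr_sqr ?nnegrE// addr_ge0.
  have := sqr_ge0 (t : R); rewrite /q; nra.
Qed.

Let integral_fluxt : (\int[mu]_p (fluxt p)%:E = 0)%E.
Proof.
apply: (integral_slicet_eq0 boxed_fluxt).
move=> v; pose c := tsq v.
have c0 : 0 <= c by exact: tsq_ge0.
pose q (y : R) : R := c ^+ 2 + 4 * y ^+ 2.
have dq (y : R) : is_derive y 1 q (8 * y).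
  by apply: is_derive_eq; rewrite /GRing.scale/=; ring.
have cq : continuous q by exact: is_derive_continuous dq.
have cmq : continuous (m \o q).
  by move=> y; apply: continuous_comp; [exact: cq|exact: cm].
have cm1q : continuous (m1 \o q).
  by move=> y; apply: continuous_comp; [exact: cq|exact: cm1].
(* On a vertical line |x|^2 is the constant c, so only 2 t and [m] are differentiated. *)
apply: (integral_derive_eq0 (F := fun y => 2 * y * c * m (q y)) (B := 1 + b)).
- move=> y; rewrite /fluxt /tquartic /= -/c -/(q y).
  have dmq := is_derive1_comp (dm (q y)) (dq y).
  by apply: is_derive_eq; rewrite /GRing.scale/=; ring.
- rewrite /fluxt /tquartic /= -/c => y; apply: cvgD.
  + by do 2!(apply: cvgM; first exact: cvg_cst); exact: cmq.
  + apply: cvgM; first exact: cvg_cst.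
    do 2!(apply: cvgM; first exact: cvg_id).
    by apply: cvgM; [exact: cvg_cst|exact: cm1q].
- move=> y By; rewrite m0 ?mulr0//.
  have y2 : (1 + b) ^+ 2 < y ^+ 2.
    by rewrite -(real_normK (num_real y)) ltr_sqr ?nnegrE// addr_ge0.
  rewrite /q; nra.
Qed.

(** Adding the fluxes, the terms in [m] contribute n + 2 from x (n from the sum, 2 from the factors
    x_i^2) and 2 from t. The terms in [m1] combine to 4 |x|^2 (|x|^4 + 4 t^2). *)
Lemma integral_divergence :
  (\int[mu]_p (tsq p.1 *
     (4 * tquartic p * m1 (tquartic p) + (n + 4)%:R * m (tquartic p)))%:E = 0)%E.
Proof.
(* The right-hand 0 is expanded as the sum of the vanishing flux integrals, which are then merged
   into one. *)
rewrite -[RHS]add0e.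
rewrite -{1}(boxed_integral_sum_eq0 (index_enum 'I_n) boxed_fluxx integral_fluxx).
rewrite -integral_fluxt -(boxed_integralD (boxed_sum _ boxed_fluxx) boxed_fluxt).
apply: eq_integral => p _; congr (_%:E).
rewrite /fluxx /fluxt 2!big_split /= -!mulr_sumr sumr_const card_ord.
have sumE (a : R) : \sum_(i < n) tnth p.1 i * (tnth p.1 i * a) = tsq p.1 * a.
  by rewrite /tsq mulr_suml; apply: eq_bigr => i _; rewrite mulrA -expr2.
rewrite !sumE natrD -mulr_natr {1}/tquartic.
by move: (p.2 : R) (tsq p.1) (m _) (m1 _) => t X k k1; ring.
Qed.

End profile.
End divergence.

(** * Radial functions in the variable rho^4 *)

Section quartic.
Variables (R : realType) (n : nat).
Local Notation point := ('rV[R]_n * R)%type.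
Implicit Types (z : point) (psi : R -> R).

(** The square of [enorm] without the square root, hence a polynomial differentiable everywhere. *)
Definition xsq (x : 'rV[R]_n) : R := \sum_(i < n) x 0 i ^+ 2.
Definition quartic z : R := xsq z.1 ^+ 2 + 4 * z.2 ^+ 2.

Lemma xsq_ge0 x : 0 <= xsq x.
Proof. by apply: sumr_ge0 => i _; exact: sqr_ge0. Qed.

Lemma quartic_ge0 z : 0 <= quartic z.
Proof. by rewrite addr_ge0 ?sqr_ge0// mulr_ge0 ?sqr_ge0. Qed.

Lemma enorm_sqr (x : 'rV[R]_n) : enorm x ^+ 2 = xsq x.
Proof. by rewrite sqr_sqrtr// xsq_ge0. Qed.

Lemma rhoE z : rho z = quartic z `^ (1 / 4).
Proof. by rewrite /rho (exprM _ 2 2) enorm_sqr. Qed.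

(** The directional difference quotient at [z] is that of the one-variable restriction at 0, so
    partial derivatives follow from calculus on R. *)
Lemma partialP k (u : point -> R) z d :
  is_derive (0 : R) 1 (fun h : R => u (h *: direction R k + z)) d ->
  partial k u z = d.
Proof.
move=> dg; rewrite -[RHS](@derive_val _ _ _ _ _ _ _ dg) /partial /derive.
congr (lim (_ @ 0^')); apply/funext => h /=.
by rewrite /shift scale0r add0r addr0 /GRing.scale/= mulr1.
Qed.

Lemma is_derive_partial k (u : point -> R) z (s : R) :
  derivable u (s *: direction R k + z) (direction R k) ->
  is_derive s 1 (fun h : R => u (h *: direction R k + z))
    (partial k u (s *: direction R k + z)).
Proof.
move=> du; have E : (fun h : R => h^-1 *:
    ((u \o shift (s *: direction R k + z)) (h *: direction R k)
    - u (s *: direction R k + z))) =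
  (fun h : R => h^-1 *:
    (((fun h : R => u (h *: direction R k + z)) \o shift s) (h *: 1)
    - u (s *: direction R k + z))).
  apply/funext => h /=; congr (_ *: (u _ - _)).
  by rewrite addrA -scalerDl /GRing.scale/= mulr1.
by split; rewrite /partial /derivable /derive -E.
Qed.

Lemma xsq_line i (h : R) x :
  xsq (h *: delta_mx 0 i + x) = xsq x + 2 * h * x 0 i + h ^+ 2.
Proof.
rewrite /xsq [in LHS](bigD1 i)//= [in RHS](bigD1 i)//= !mxE !eqxx/= mulr1.
rewrite (eq_bigr (fun j => x 0 j ^+ 2)); first by ring.
by move=> j /negPf ji; rewrite !mxE ji andbF mulr0 add0r.
Qed.

Definition dquartic k z : R :=
  if k is Some i then 4 * xsq z.1 * z.1 0 i else 8 * z.2.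

Lemma is_derive_quartic k z :
  is_derive (0 : R) 1 (fun h : R => quartic (h *: direction R k + z)) (dquartic k z).
Proof.
rewrite /quartic; case: k => [i|] /=.
  under eq_fun do rewrite xsq_line.
  by apply: is_derive_eq; rewrite /GRing.scale/=; ring.
under eq_fun do rewrite scaler0 add0r.
by apply: is_derive_eq; rewrite /GRing.scale/=; ring.
Qed.

Lemma is_derive_profile k psi d z : is_derive (quartic z) 1 psi d ->
  is_derive (0 : R) 1 (fun h : R => psi (quartic (h *: direction R k + z)))
    (d * dquartic k z).
Proof.
move=> dpsi; apply: is_derive1_comp (is_derive_quartic k z).
by rewrite scale0r add0r.
Qed.

Lemma partial_profile k psi d z : is_derive (quartic z) 1 psi d ->
  partial k (psi \o quartic) z = d * dquartic k z.
Proof. by move=> dpsi; apply/partialP/is_derive_profile. Qed.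

Lemma sum_xsq z (c : R) : \sum_(i < n) c * z.1 0 i ^+ 2 = c * xsq z.1.
Proof. by rewrite mulr_sumr. Qed.

(** Chain rule with |grad_G rho^4|^2 = 16 |x|^6 + 64 |x|^2 t^2 = 16 |x|^2 rho^4. The derivative is
    taken at one point, so real powers of rho^4 are covered off the origin. *)
Lemma sqlen_grad_profile psi d z : is_derive (quartic z) 1 psi d ->
  sqlen (grushin_grad (psi \o quartic) z) = 16 * d ^+ 2 * xsq z.1 * quartic z.
Proof.
move=> dpsi; rewrite /sqlen /grushin_grad /= /pdt /pdx (partial_profile None dpsi)/=.
under eq_bigr do rewrite mxE (partial_profile _ dpsi)/= mulrA exprMn.
rewrite sum_xsq [X in _ + X](_ : _ = enorm z.1 ^+ 2 * (d * (8 * z.2)) ^+ 2); last by ring.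
rewrite enorm_sqr /quartic; ring.
Qed.

(** With p = rho^4, L_G psi(p) = psi'' |grad_G p|^2 + psi' L_G p, where L_G p = 4 (n + 2) |x|^2 + 8
    |x|^2. *)
Lemma grushin_op_profile psi psi1 (psi2 : R) z :
  (forall p : R, is_derive p 1 psi (psi1 p)) ->
  is_derive (quartic z) 1 psi1 psi2 ->
  grushin_op (psi \o quartic) z =
  xsq z.1 * (16 * quartic z * psi2 + 4 * (n + 4)%:R * psi1 (quartic z)).
Proof.
move=> dpsi dpsi1; rewrite /grushin_op enorm_sqr.
have partialE k : partial k (psi \o quartic) =
    fun y => psi1 (quartic y) * dquartic k y.
  by apply/funext => y; exact: partial_profile.
have -> : pdt (pdt (psi \o quartic)) z =
    psi2 * (64 * z.2 ^+ 2) + psi1 (quartic z) * 8.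
  rewrite /pdt partialE; apply: partialP; rewrite /dquartic/=.
  have dP := is_derive_profile None dpsi1.
  apply: is_derive_eq; rewrite scale0r !add0r ?mul0r ?add0r /GRing.scale/=; ring.
have pdxE i : pdx i (pdx i (psi \o quartic)) z =
    psi1 (quartic z) * 4 * xsq z.1 +
    (16 * psi2 * xsq z.1 ^+ 2 + 8 * psi1 (quartic z)) * z.1 0 i ^+ 2.
  rewrite /pdx partialE; apply: partialP; rewrite /dquartic/=.
  have dP := is_derive_profile (Some i) dpsi1.
  under eq_fun do rewrite xsq_line !mxE !eqxx mulr1.
  apply: is_derive_eq; rewrite scale0r !add0r ?mul0r ?add0r /GRing.scale/=; ring.
under eq_bigr do rewrite pdxE.
rewrite big_split/= sumr_const card_ord sum_xsq natrD -mulr_natr /quartic.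
ring.
Qed.

(** Euler's relation: rho^4 has degree 4 for the field x d/dx + 2 t d/dt. *)
Lemma radial_deriv_profile psi d z : is_derive (quartic z) 1 psi d ->
  radial_deriv (psi \o quartic) z = 4 * d * quartic z / rho z.
Proof.
move=> dpsi; rewrite /radial_deriv /pdt /pdx (partial_profile None dpsi)/=.
rewrite (eq_bigr (fun i => d * 4 * xsq z.1 * z.1 0 i ^+ 2)); last first.
  by move=> i _; rewrite (partial_profile _ dpsi)/=; ring.
by rewrite sum_xsq /quartic; ring.
Qed.

End quartic.

Arguments xsq {R n} x.
Arguments quartic {R n} z.

(** * Real powers and square roots of functions vanishing near 0 *)

Section profiles.
Variable R : realType.
Implicit Types (g phi : R -> R) (a alpha p s : R).

(** Below [a] the product is identically 0, which hides the singularity of the power at 0; from [a]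
    on the usual product rule applies. *)
Lemma is_derive_powRM a alpha phi phi1 : 0 < a -> (forall p, p < a -> phi p = 0) ->
  (forall p, is_derive p 1 phi (phi1 p)) ->
  forall p, is_derive p 1 (fun x => x `^ alpha * phi x)
    (p `^ alpha * phi1 p + alpha * p `^ (alpha - 1) * phi p).
Proof.
move=> a0 phi0 dphi p; have [pa|ap] := ltP p a.
  have phi10 : phi1 p = 0.
    apply: (is_derive_eq0 (A := [set x | x < a])) (dphi p) => //.
    by move=> x; rewrite inE; exact: phi0.
  rewrite phi10 phi0// !mulr0 addr0.
  have d0 : is_derive p 1 (cst 0 : R -> R) (0 : R) by exact: is_derive_cst.
  apply: near_eq_is_derive d0.
  by near=> x; rewrite phi0 ?mulr0//; near: x; exact: lt_nbhsl.
have p0 : 0 < p by exact: lt_le_trans ap.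
have dp := is_derive1_powR alpha p0.
by apply: is_derive_eq; rewrite /GRing.scale/=; ring.
Unshelve. all: by end_near. Qed.

Lemma continuous_powRM a alpha phi : 0 < a -> (forall p, p < a -> phi p = 0) ->
  continuous phi -> continuous (fun x => x `^ alpha * phi x).
Proof.
move=> a0 phi0 cphi p; have [pa|ap] := ltP p a.
  rewrite /continuous_at phi0// mulr0.
  have c0 : (cst 0 : R -> R) @ p --> (0 : R) by exact: cvg_cst.
  apply: cvg_trans c0; apply: near_eq_cvg; near=> x.
  by rewrite phi0 ?mulr0//; near: x; exact: lt_nbhsl.
have p0 : 0 < p by exact: lt_le_trans ap.
have cp : {for p, continuous (fun x : R => x `^ alpha)}.
  apply/differentiable_continuous/derivable1_diffP.
  exact: @ex_derive _ _ _ _ _ _ _ (is_derive1_powR alpha p0).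
by apply: cvgM; [exact: cp|exact: cphi].
Unshelve. all: by end_near. Qed.

Lemma sqrt_half_lt e p : 0 < e -> p < e ^+ 2 -> Num.sqrt p / 2 < e.
Proof.
move=> e0 pe; rewrite ltr_pdivrMr// (@le_lt_trans _ _ e)//; last by lra.
by rewrite -(ger0_norm (ltW e0)) -sqrtr_sqr ler_wsqrtr// ltW.
Qed.

(** Only the half-line s >= 0 enters the profile; cutting off the rest gives vanishing for all s <
    e. The cut is smooth because [g] already vanishes just below [e]. *)
Lemma is_derive_truncate e g g1 : 0 < e -> (forall s, `|s| < e -> g s = 0) ->
  (forall s, is_derive s 1 g (g1 s)) ->
  forall s, is_derive s 1 (fun x => if x < e then 0 else g x)
    (if s < e then 0 else g1 s).
Proof.
move=> e0 g0 dg s; case: ltP => [se|es].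
  have d0 : is_derive s 1 (cst 0 : R -> R) (0 : R) by exact: is_derive_cst.
  apply: near_eq_is_derive d0; near=> x.
  by rewrite ifT//; near: x; exact: lt_nbhsl.
apply: near_eq_is_derive (dg s); near=> x; case: ltP => // xe; rewrite g0//.
have x0 : 0 < x by near: x; apply: lt_nbhsr; exact: lt_le_trans es.
by rewrite gtr0_norm.
Unshelve. all: by end_near. Qed.

(* The factor [s `^ (-1)] is harmless at [s = 0] because [g1] vanishes near [0]. *)
Lemma is_derive_comp_sqrt e g g1 : 0 < e -> (forall s, s < e -> g s = 0) ->
  (forall s, is_derive s 1 g (g1 s)) ->
  forall p, is_derive p 1 (fun x => g (Num.sqrt x / 2))
    (8^-1 * ((Num.sqrt p / 2) `^ (-1) * g1 (Num.sqrt p / 2))).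
Proof.
move=> e0 g0 dg p; have [p0|p0] := ltP 0 p.
  have s0 : 0 < Num.sqrt p by rewrite sqrtr_gt0.
  have ds := is_derive1_sqrt p0.
  (* With s = sqrt p / 2, this derivative 1 / (4 sqrt p) is 1 / (8 s), the source of the factor
     1/8. *)
  have dh : is_derive p 1 (fun x => Num.sqrt x / 2) ((4 * Num.sqrt p)^-1).
    apply: is_derive_eq; rewrite /GRing.scale/=.
    by field; rewrite gt_eqF.
  apply: is_derive_eq (is_derive1_comp (dg _) dh) _ => /=.
  rewrite powR_inv1; last by rewrite divr_ge0// ltW.
  by field; rewrite gt_eqF.
have pe : p < e ^+ 2 by rewrite (le_lt_trans p0)// exprn_gt0.
rewrite [X in is_derive _ _ _ X](_ : _ = 0); last first.
  rewrite (is_derive_eq0 (A := [set x | x < e]) _ _ _ (dg _)) ?mulr0//.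
    exact: sqrt_half_lt.
  by move=> x; rewrite inE; exact: g0.
have d0 : is_derive p 1 (cst 0 : R -> R) (0 : R) by exact: is_derive_cst.
apply: near_eq_is_derive d0.
by near=> x; rewrite g0// sqrt_half_lt//; near: x; exact: lt_nbhsl.
Unshelve. all: by end_near. Qed.

Lemma continuous_comp_sqrt g : continuous g -> continuous (fun x => g (Num.sqrt x / 2)).
Proof.
move=> cg p; apply: (@continuous_comp _ _ _ (fun x => Num.sqrt x / 2) g); last exact: cg.
by apply: cvgM; [exact: sqrt_continuous|exact: cvg_cst].
Qed.

End profiles.

(** * The profile of a radial test function *)

Section radial_profile.
Variables (R : realType) (n : nat).
Local Notation point := ('rV[R]_n * R)%type.
Implicit Types (u : point -> R).

Lemma Ccinfty_axis_support u : Ccinfty_off_origin u ->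
  exists e M : R, [/\ 0 < e, forall s, `|s| < e -> u (0, s) = 0 &
    forall s, M < `|s| -> u (0, s) = 0].
Proof.
move=> [_ cu u0].
have : nbhs (0 : point) (~` closure [set z | u z != 0]).
  by apply: open_nbhs_nbhs; split=> //; apply: closed_openC; exact: closed_closure.
move=> /nbhs_ballP[e e0 eu].
have [M [_ uM]] := compact_bounded cu.
(* [compact_bounded] provides the bound for every number strictly above [M], hence M + 1. *)
exists e, (M + 1); split=> // s se; apply/eqP/negPn/negP => us.
- apply: (eu (0, s)); last exact: subset_closure.
  by split; [exact: ballxx|rewrite /ball/= sub0r normrN].
- have /(_ (0, s) (@subset_closure _ [set z | u z != 0] _ us)) :=
    uM (M + 1) (ltr_pwDr ltr01 (lexx M)).
  by rewrite /= prod_normE /= ge_max [X in _ && X]leNgt se andbF.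
Qed.

(** The function [F] given by radiality carries no regularity, so the profile is read off the t
    axis: (0, sqrt p / 2) has rho^4 = p, whence f(p) = u(0, sqrt p / 2). Smoothness at p = 0 holds
    because [u] vanishes near the origin. *)
Lemma radial_profile u : Ccinfty_off_origin u -> radial u ->
  exists a b : R, exists f f1 f2 : R -> R,
  [/\ 0 < a /\ 0 <= b,
      (forall p : R, is_derive p 1 f (f1 p)) /\
      (forall p : R, is_derive p 1 f1 (f2 p)),
      continuous f2,
      (forall p, p < a -> f p = 0) /\ (forall p, b < p -> f p = 0) &
      u = f \o quartic].
Proof.
move=> uC [F uF]; have [e [M [e0 ue uM]]] := Ccinfty_axis_support uC.
have [su _ _] := uC.
pose t (j : nat) (s : R) : R := iter_partial (nseq j None) u (0, s).
have dt j (s : R) : is_derive s 1 (t j) (t j.+1 s).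
  have E (h : R) : (0, h) = h *: direction R None + (0 : point).
    by rewrite addr0 /direction /= /GRing.scale /= /scale_pair /= scaler0 /GRing.scale/= mulr1.
  have [_ /(_ None (s *: direction R None + 0))] := su (nseq j None).
  move=> /is_derive_partial.
  by rewrite -E; under eq_fun do rewrite -E.
have t0 j s : `|s| < e -> t j s = 0.
  elim: j s => [|j IHj] s se; first exact: ue.
  apply: (is_derive_eq0 (A := [set x | `|x| < e])) (dt j s) => //.
    by apply: (open_comp _ (@open_lt _ e)) => x _; exact: norm_continuous.
  by move=> x; rewrite inE; exact: IHj.
pose T j s := if s < e then 0 else t j s.
have T0 j s : s < e -> T j s = 0 by rewrite /T => ->.
have dT j (s : R) : is_derive s 1 (T j) (T j.+1 s).
  by apply: is_derive_truncate => //; exact: t0.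
(* With s = sqrt p / 2, each d/dp is (1 / (8 s)) d/ds: thus f' = k(s) / 8 and f'' = k'(s) / (64
   s). *)
pose k s : R := s `^ (-1) * T 1%N s.
pose k' s : R := s `^ (-1) * T 2 s + -1 * s `^ (-1 - 1) * T 1%N s.
have dk (s : R) : is_derive s 1 k (k' s) by exact: is_derive_powRM e0 (T0 1%N) (dT 1%N) s.
have ck' : continuous k'.
  have cT j : continuous (T j) by exact: is_derive_continuous (dT j).
  move=> s; apply: cvgD; first exact: (continuous_powRM e0 (T0 _) (cT _)).
  under eq_fun do rewrite -mulrA.
  by rewrite -mulrA; apply: cvgM; [exact: cvg_cst|exact: (continuous_powRM e0 (T0 _) (cT _))].
(* p < e^2 forces sqrt p / 2 < e, and p beyond the second value forces sqrt p / 2 > |M| + 1 > M. *)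
exists (e ^+ 2), ((2 * (`|M| + 1)) ^+ 2).
exists (fun p => T 0%N (Num.sqrt p / 2)), (fun p => 8^-1 * k (Num.sqrt p / 2)).
exists (fun p => 8^-1 * (8^-1 * ((Num.sqrt p / 2) `^ (-1) * k' (Num.sqrt p / 2)))).
have rho0 (s : R) : rho ((0, s) : point) = (4 * s ^+ 2) `^ (1 / 4).
  rewrite rhoE /quartic /xsq big1 ?expr0n ?add0r//= => i _.
  by rewrite mxE expr0n.
split.
- by rewrite exprn_gt0// sqr_ge0.
- split=> p; first exact: (is_derive_comp_sqrt e0 (T0 0%N) (dT 0%N)).
  have k0 s : s < e -> k s = 0 by move=> se; rewrite /k T0// mulr0.
  have dkp := is_derive_comp_sqrt e0 k0 dk p.
  by apply: is_derive_eq; rewrite /GRing.scale/= mulr1.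
- have k'0 s : s < e -> k' s = 0 by move=> se; rewrite /k' !T0// !mulr0 addr0.
  have c := continuous_comp_sqrt (continuous_powRM (alpha := -1) e0 k'0 ck').
  by move=> p; do 2!(apply: cvgM; first exact: cvg_cst); exact: c.
- split=> p pp; first by rewrite T0// sqrt_half_lt.
  rewrite /T; case: ltP => // _; apply: uM.
  have M1 : 0 <= 2 * (`|M| + 1) by rewrite mulr_ge0// addr_ge0.
  have : 2 * (`|M| + 1) < Num.sqrt p.
    by rewrite -(ger0_norm M1) -sqrtr_sqr ltr_sqrt// (le_lt_trans _ pp)// sqr_ge0.
  rewrite (ger0_norm (divr_ge0 (sqrtr_ge0 _) (ler0n _ _))) => Mp.
  by rewrite ltr_pdivlMr//; have := ler_norm M; lra.
- apply/funext => z /=; have -> : u z = u (0, Num.sqrt (quartic z) / 2).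
    rewrite 2!uF rho0 rhoE; congr (F (_ `^ _)).
    by rewrite expr_div_n sqr_sqrtr ?quartic_ge0//; field.
  (* Where the truncation replaces the axis value by 0, [u] vanishes as well. *)
  by rewrite /T; case: ltP => // se; rewrite ue// ger0_norm.
Qed.

End radial_profile.

(** * The integrals as weighted integrals of profiles *)

Lemma powRD_gt0 (R : realType) (x r s : R) : 0 < x ->
  x `^ (r + s) = x `^ r * x `^ s.
Proof. by move=> x0; rewrite powRD// (gt_eqF x0) implybT. Qed.

Section weighted_integral.
Variables (R : realType) (n : nat) (a b : R) (a_gt0 : 0 < a) (b_ge0 : 0 <= b).
Implicit Types phi psi : R -> R.

(** Vanishing below [a] > 0 absorbs negative powers of p; vanishing above [b] keeps the integrands
    in a box, so that integrals in the extended reals add. *)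
Definition annular phi : Prop :=
  [/\ continuous phi, forall p, p < a -> phi p = 0 & forall p, b < p -> phi p = 0].

Lemma annularM phi psi : continuous psi -> annular phi ->
  annular (fun p => psi p * phi p).
Proof.
move=> cpsi [cphi phia phib]; split.
- by move=> p; apply: cvgM; [exact: cpsi|exact: cphi].
- by move=> p /phia ->; rewrite mulr0.
- by move=> p /phib ->; rewrite mulr0.
Qed.

Lemma annularD phi psi : annular phi -> annular psi ->
  annular (fun p => phi p + psi p).
Proof.
move=> [cphi phia phib] [cpsi psia psib]; split.
- by move=> p; apply: cvgD; [exact: cphi|exact: cpsi].
- by move=> p pa; rewrite phia// psia// addr0.
- by move=> p pb; rewrite phib// psib// addr0.
Qed.

Lemma annular_sqr phi : annular phi -> annular (fun p => phi p ^+ 2).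
Proof. by move=> aphi; apply: annularM => //; case: aphi. Qed.

Lemma annular_derive phi phi1 : annular phi -> continuous phi1 ->
  (forall p : R, is_derive p 1 phi (phi1 p)) -> annular phi1.
Proof.
move=> [_ phia phib] cphi1 dphi; split=> // p pab.
- apply: (is_derive_eq0 (A := [set x | x < a])) (dphi p) => //.
  by move=> x; rewrite inE; exact: phia.
- apply: (is_derive_eq0 (A := [set x | b < x])) (dphi p) => //.
  by move=> x; rewrite inE; exact: phib.
Qed.

(** This is rho^(-6), as in |grad_G rho|^2 / rho^4 = |x|^2 rho^(-6). *)
Definition weight (p : R) : R := p `^ (- 3 / 2).

Lemma annular_weight phi : annular phi -> annular (fun p => weight p * phi p).
Proof.
move=> [cphi phia phib]; split; first exact: continuous_powRM a_gt0 phia cphi.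
- by move=> p /phia ->; rewrite mulr0.
- by move=> p /phib ->; rewrite mulr0.
Qed.

Definition radial_integral phi : \bar R :=
  (\int[lebesgue_tuple R n \x @lebesgue_measure R]_p
     (tsq p.1 * (weight (tquartic p) * phi (tquartic p)))%:E)%E.

Lemma integral_dxdt_radial (f : 'rV[R]_n * R -> R) phi :
  (forall z, f z = xsq z.1 * (weight (quartic z) * phi (quartic z))) ->
  integral_dxdt f = radial_integral phi.
Proof.
move=> fE; apply: eq_integral => p _; rewrite fE /quartic /tquartic /=.
rewrite (_ : xsq (\row_i tnth p.1 i) = tsq p.1)//.
by apply: eq_bigr => i _; rewrite mxE.
Qed.

Let boxed_radial phi : annular phi ->
  boxed (box (n := n) (1 + b))
    (fun p => tsq p.1 * (weight (tquartic p) * phi (tquartic p))).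
Proof.
move=> /annular_weight[cphi _ phib]; apply: boxed_tsq.
exact: (boxed_profile n b_ge0 cphi phib).
Qed.

Lemma radial_integralD phi psi : annular phi -> annular psi ->
  radial_integral (fun p => phi p + psi p) =
  (radial_integral phi + radial_integral psi)%E.
Proof.
move=> aphi apsi.
rewrite /radial_integral -(boxed_integralD (boxed_radial aphi) (boxed_radial apsi)).
by apply: eq_integral => p _; rewrite !mulrDr.
Qed.

Lemma radial_integralZ c phi : annular phi ->
  radial_integral (fun p => c * phi p) = (c%:E * radial_integral phi)%E.
Proof.
move=> aphi; rewrite /radial_integral -(boxed_integralZ c (boxed_radial aphi)).
by apply: eq_integral => p _; congr (_%:E); rewrite !(mulrCA c).
Qed.

(** The divergence identity for m = p^(-3/2) phi: differentiating the power contributes -6 phi to 4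
    p m', which turns n + 4 into n - 2. *)
Lemma radial_integral_div phi phi1 : annular phi -> continuous phi1 ->
  (forall p : R, is_derive p 1 phi (phi1 p)) ->
  radial_integral (fun p => 4 * p * phi1 p + (n%:R - 2) * phi p) = 0%E.
Proof.
move=> aphi cphi1 dphi; have [_ phi1a _] := annular_derive aphi cphi1 dphi.
have [cphi phia phib] := aphi.
have dm := is_derive_powRM (- 3 / 2) a_gt0 phia dphi.
have cm1 : continuous (fun p => p `^ (- 3 / 2) * phi1 p +
    - 3 / 2 * p `^ (- 3 / 2 - 1) * phi p).
  move=> p; apply: cvgD; first exact: continuous_powRM a_gt0 phi1a cphi1 p.
  rewrite -mulrA; under eq_fun do rewrite -mulrA.
  by apply: cvgM; [exact: cvg_cst|exact: continuous_powRM a_gt0 phia cphi p].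
have mb p : b < p -> p `^ (- 3 / 2) * phi p = 0 by move=> /phib ->; rewrite mulr0.
rewrite -(integral_divergence n b_ge0 dm cm1 mb).
apply: eq_integral => p _; congr (_ * _)%:E; rewrite /weight.
have := tquartic_ge0 p; move: (tquartic p) => q.
rewrite le_eqVlt => /predU1P[<-|q0].
  by rewrite phia// phi1a// !(mulr0, addr0).
have -> : q `^ (- 3 / 2 - 1) = q `^ (- 3 / 2) / q.
  by rewrite powRD_gt0// powR_inv1// ltW.
by rewrite natrD; field; rewrite gt_eqF.
Qed.

End weighted_integral.

(** * Pointwise formulas for the five integrands *)

Section integrands.
Variables (R : realType) (n : nat).
Local Notation point := ('rV[R]_n * R)%type.
Implicit Types z : point.

Lemma powR_weight (p alpha beta : R) : 0 < p -> 2 * alpha + beta = - 3 / 2 + 1 ->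
  (p `^ alpha) ^+ 2 * p `^ beta = p * weight p.
Proof.
move=> p0 E; have -> : p * weight p = p `^ (1 + - 3 / 2) by rewrite powRD_gt0// powRr1// ltW.
rewrite -powR_mulrn ?powR_ge0// -powRrM -powRD_gt0//.
by rewrite mulrC E addrC.
Qed.

Lemma weight_gt0 (p : R) : 0 < p -> 0 < weight p.
Proof. exact: powR_gt0. Qed.

(** This relation lets [field] treat the weight as an indeterminate: a side is multiplied by this
    form of 1. *)
Lemma weight_sqr (p : R) : 0 < p -> p ^+ 3 * weight p ^+ 2 = 1.
Proof.
move=> p0; rewrite /weight -!powR_mulrn ?powR_ge0 ?ltW//.
rewrite -powRrM -powRD_gt0//; have -> : 3%:R + - 3 / 2 * 2%:R = 0 :> R by field.
by rewrite powRr0.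
Qed.

Lemma sqlen_grad_rho z : 0 < quartic z ->
  sqlen (grushin_grad rho z) = xsq z.1 * (quartic z * weight (quartic z)).
Proof.
move=> z0; have -> : @rho R n = (@powR R ^~ (1 / 4)) \o quartic.
  by apply/funext => y; exact: rhoE.
rewrite (sqlen_grad_profile (is_derive1_powR (1 / 4) z0)) exprMn.
rewrite -[X in _ = _ * X](@powR_weight _ (1 / 4 - 1) 1)//; last by field.
by rewrite powRr1 ?ltW//; field.
Qed.

Lemma rho_exp4 z : rho z ^+ 4 = quartic z.
Proof.
by rewrite rhoE -powR_mulrn ?powR_ge0// -powRrM div1r mulVf ?powRr1 ?quartic_ge0.
Qed.

End integrands.

Section integrands.
Variables (R : realType) (n : nat) (a : R) (f f1 f2 : R -> R).
Hypotheses (a_gt0 : 0 < a) (fa : forall p, p < a -> f p = 0).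
Hypotheses (df : forall p : R, is_derive p 1 f (f1 p)).
Hypotheses (df1 : forall p : R, is_derive p 1 f1 (f2 p)).
Local Notation point := ('rV[R]_n * R)%type.
Local Notation u := (f \o @quartic R n).
Local Notation Q := ((n + 2)%:R : R).
Implicit Types z : point.

Let derive_profile_eq0 p : p < a -> f1 p = 0.
Proof.
move=> pa; apply: (is_derive_eq0 (A := [set x | x < a])) (df p) => //.
by move=> x; rewrite inE; exact: fa.
Qed.

(** At the origin the factor |x|^2 kills both sides of each integrand formula; elsewhere rho is
    invertible. *)
Lemma quartic_cases z : quartic z = 0 /\ xsq z.1 = 0 \/ 0 < quartic z.
Proof.
have := quartic_ge0 z; rewrite le_eqVlt => /predU1P[/esym z0|]; last by right.
left; split=> //; apply/eqP; rewrite -sqrf_eq0 eq_le sqr_ge0 andbT -z0.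
by rewrite lerDl mulr_ge0 ?sqr_ge0.
Qed.

Lemma rho_sqr z : 0 < quartic z -> rho z ^+ 2 = quartic z ^+ 2 * weight (quartic z).
Proof.
move=> z0; rewrite rhoE -powR_mulrn ?powR_ge0// -powRrM /weight.
rewrite -[quartic z ^+ 2]powR_mulrn ?quartic_ge0// -powRD_gt0//.
by congr (_ `^ _); field.
Qed.

Lemma integrand_op z :
  grushin_op u z ^+ 2 / sqlen (grushin_grad rho z) =
  xsq z.1 * (weight (quartic z) * (quartic z ^+ 2 *
    (16 * quartic z * f2 (quartic z) + 4 * (n + 4)%:R * f1 (quartic z)) ^+ 2)).
Proof.
rewrite (grushin_op_profile df (df1 _)).
case: (quartic_cases z) => [[_ ->]|z0]; first by rewrite !mul0r expr0n/= mul0r.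
rewrite sqlen_grad_rho//; set A := _ + _.
(* On the t axis |grad_G rho| = 0; the quotient is 0 by the convention for division by 0, matching
   the factor |x|^2 on the right. *)
have [->|x0] := eqVneq (xsq z.1) 0; first by rewrite !mul0r expr0n/= mul0r.
rewrite -[LHS]mulr1 -(weight_sqr z0); field.
by rewrite x0 !gt_eqF ?weight_gt0.
Qed.

Lemma integrand_grad z :
  sqlen (grushin_grad u z) / rho z ^+ 2 =
  xsq z.1 * (weight (quartic z) * (16 * quartic z ^+ 2 * f1 (quartic z) ^+ 2)).
Proof.
rewrite (sqlen_grad_profile (df _)).
case: (quartic_cases z) => [[_ ->]|z0]; first by rewrite !(mul0r, mulr0).
rewrite rho_sqr// -[LHS]mulr1 -(weight_sqr z0); field.
by rewrite !gt_eqF ?weight_gt0.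
Qed.

Lemma integrand_fun z :
  `|u z| ^+ 2 * sqlen (grushin_grad rho z) / rho z ^+ 4 =
  xsq z.1 * (weight (quartic z) * f (quartic z) ^+ 2).
Proof.
rewrite rho_exp4 real_normK ?num_real//=.
case: (quartic_cases z) => [[z0 x0]|z0].
  by rewrite z0 x0 invr0 mulr0 mul0r.
by rewrite sqlen_grad_rho//; field; rewrite gt_eqF.
Qed.

Lemma integrand_rem0 z :
  rho z `^ (2 - Q) *
    sqlen (grushin_grad (fun y => u y * rho y `^ ((Q - 4) / 2)) z) =
  xsq z.1 * (weight (quartic z) *
    (16 * (quartic z * f1 (quartic z) + (Q - 4) / 8 * f (quartic z)) ^+ 2)).
Proof.
(* The exponent (Q - 4) / 2 of rho expressed in p = rho^4. *)
pose alpha := (Q - 4) / 8.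
have -> : (fun y => u y * rho y `^ ((Q - 4) / 2)) =
    (fun p => p `^ alpha * f p) \o @quartic R n.
  apply/funext => y /=; rewrite rhoE -powRrM mulrC; congr (_ `^ _ * _).
  by rewrite /alpha; field.
rewrite (sqlen_grad_profile (is_derive_powRM alpha a_gt0 fa df _)).
case: (quartic_cases z) => [[_ ->]|z0]; first by rewrite !(mul0r, mulr0).
have -> : quartic z `^ (alpha - 1) = quartic z `^ alpha / quartic z.
  by rewrite powRD_gt0// powR_inv1// ltW.
have E : (quartic z `^ alpha) ^+ 2 * rho z `^ (2 - Q) = quartic z * weight (quartic z).
  by rewrite rhoE -powRrM; apply: powR_weight => //; rewrite /alpha; field.
rewrite -/alpha; transitivity (xsq z.1 * (
    ((quartic z `^ alpha) ^+ 2 * rho z `^ (2 - Q)) / quartic z *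
    (16 * (quartic z * f1 (quartic z) + alpha * f (quartic z)) ^+ 2))).
  by field; rewrite gt_eqF.
by rewrite E; field; rewrite gt_eqF.
Qed.

Lemma integrand_rem1 z :
  rho z `^ (2 - Q) *
    sqlen (grushin_grad (fun y => radial_deriv u y * rho y `^ ((Q - 2) / 2)) z) =
  xsq z.1 * (weight (quartic z) * (quartic z ^+ 2 *
    (16 * quartic z * f2 (quartic z) + 2 * (Q + 4) * f1 (quartic z)) ^+ 2)).
Proof.
(* u_rho = 4 p^(3/4) f', and 3/4 + (Q - 2) / 8 = (Q + 4) / 8. *)
pose alpha := (Q + 4) / 8.
have -> : (fun y => radial_deriv u y * rho y `^ ((Q - 2) / 2)) =
    (fun p => p `^ alpha * (4 * f1 p)) \o @quartic R n.
  apply/funext => y /=; rewrite (radial_deriv_profile (df _)).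
  case: (quartic_cases y) => [[-> _]|y0].
    by rewrite derive_profile_eq0// !(mulr0, mul0r).
  rewrite rhoE -powRrM -powR_inv1 ?powR_ge0// -powRrM.
  have -> : alpha = 1 + ((1 / 4) * -1 + (1 / 4) * ((Q - 2) / 2)).
    by rewrite /alpha; field.
  rewrite !powRD_gt0// powRr1 ?ltW//; ring.
have f1a p : p < a -> 4 * f1 p = 0.
  by move=> pa; rewrite derive_profile_eq0// mulr0.
have d4 (p : R) : is_derive p 1 (fun x => 4 * f1 x) (4 * f2 p).
  have := df1 p => dp; apply: is_derive_eq; rewrite /GRing.scale/=; ring.
rewrite (sqlen_grad_profile (is_derive_powRM alpha a_gt0 f1a d4 _)).
case: (quartic_cases z) => [[_ ->]|z0]; first by rewrite !(mul0r, mulr0).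
have -> : quartic z `^ (alpha - 1) = quartic z `^ alpha / quartic z.
  by rewrite powRD_gt0// powR_inv1// ltW.
have E : (quartic z `^ alpha) ^+ 2 * rho z `^ (2 - Q) =
    quartic z ^+ 3 * weight (quartic z).
  rewrite rhoE -powRrM.
  transitivity (quartic z ^+ 2 * (quartic z * weight (quartic z))); last by ring.
  (* The total exponent is 3/2, two above that of p times the weight; lowering [alpha] by 1 removes
     the excess p^2. *)
  rewrite -(@powR_weight _ _ (alpha - 1) (1 / 4 * (2 - Q)))//.
    by rewrite powRD_gt0// powR_inv1 ?ltW//; field; rewrite gt_eqF.
  by rewrite /alpha; field.
transitivity (xsq z.1 * (
    ((quartic z `^ alpha) ^+ 2 * rho z `^ (2 - Q)) / quartic z *
    (16 * quartic z * f2 (quartic z) + 2 * (Q + 4) * f1 (quartic z)) ^+ 2)).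
  by rewrite /alpha; field; rewrite gt_eqF.
by rewrite E; field; rewrite gt_eqF.
Qed.

End integrands.

(** * The two identities, from pointwise identities modulo divergences *)

Theorem corollary1p2 (R : realType) (n : nat) (n_ge2 : (2 <= n)%N)
    (u : 'rV[R]_n * R -> R) (u_Cc : Ccinfty_off_origin u) (u_rad : radial u) :
  let Q : R := (n + 2)%:R in
  let int_Lu : \bar R :=
    integral_dxdt (fun z => grushin_op u z ^+ 2 / sqlen (grushin_grad rho z)) in
  let int_grad : \bar R :=
    integral_dxdt (fun z => sqlen (grushin_grad u z) / rho z ^+ 2) in
  let int_u : \bar R :=
    integral_dxdt (fun z =>
      `|u z| ^+ 2 * sqlen (grushin_grad rho z) / rho z ^+ 4) in
  let int_rem0 : \bar R :=
    integral_dxdt (fun z => rho z `^ (2 - Q) *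
      sqlen (grushin_grad (fun y => u y * rho y `^ ((Q - 4) / 2)) z)) in
  let int_rem1 : \bar R :=
    integral_dxdt (fun z => rho z `^ (2 - Q) *
      sqlen (grushin_grad
        (fun y => radial_deriv u y * rho y `^ ((Q - 2) / 2)) z)) in
  (int_Lu = (Q ^+ 2 / 4)%:E * int_grad + int_rem1)%E
  /\
  (int_Lu = (Q ^+ 2 * (Q - 4) ^+ 2 / 16)%:E * int_u
            + (Q ^+ 2 / 4)%:E * int_rem0 + int_rem1)%E.
Proof.
move=> Q int_Lu int_grad int_u int_rem0 int_rem1.
have [a [b [f [f1 [f2 [[a0 b0] [df df1] cf2 [fa fb] uE]]]]]] := radial_profile u_Cc u_rad.
have af : annular a b f by split=> //; exact: is_derive_continuous df.
have cf1 : continuous f1 by exact: is_derive_continuous df1.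
have af1 : annular a b f1 by exact: annular_derive af cf1 df.
have af2 : annular a b f2 by exact: annular_derive af1 cf2 df1.
have cX k (c : R) : continuous (fun p : R => c * p ^+ k).
  by move=> p; apply: cvgM; [exact: cvg_cst|exact: exprn_continuous].
have aM k c (phi : R -> R) : annular a b phi ->
    annular a b (fun p => c * p ^+ k * phi p).
  by move=> aphi; exact: annularM (cX k c) aphi.
have aZ (c : R) phi : annular a b phi -> annular a b (fun p => c * phi p).
  by apply: annularM => p; exact: cvg_cst.
have -> : int_Lu = radial_integral n (fun p : R =>
    p ^+ 2 * (16 * p * f2 p + 4 * (n + 4)%:R * f1 p) ^+ 2).
  by apply: integral_dxdt_radial => z; rewrite uE; exact: integrand_op.
have -> : int_grad = radial_integral n (fun p : R => 16 * p ^+ 2 * f1 p ^+ 2).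
  by apply: integral_dxdt_radial => z; rewrite uE; exact: integrand_grad.
have -> : int_u = radial_integral n (fun p : R => f p ^+ 2).
  by apply: integral_dxdt_radial => z; rewrite uE; exact: integrand_fun.
have -> : int_rem0 = radial_integral n (fun p : R =>
    16 * (p * f1 p + (Q - 4) / 8 * f p) ^+ 2).
  by apply: integral_dxdt_radial => z; rewrite uE; exact: (integrand_rem0 a0 fa).
have -> : int_rem1 = radial_integral n (fun p : R =>
    p ^+ 2 * (16 * p * f2 p + 2 * (Q + 4) * f1 p) ^+ 2).
  by apply: integral_dxdt_radial => z; rewrite uE; exact: (integrand_rem1 a0 fa).
have alin (c : R) : annular a b (fun p => 16 * p * f2 p + c * f1 p).
  by apply: annularD; [exact: (aM 1%N)|exact: aZ].
have asq (phi : R -> R) : annular a b phi -> annular a b (fun p => p ^+ 2 * phi p ^+ 2).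
  by move=> aphi; apply: annularM (annular_sqr aphi) => p; exact: exprn_continuous.
have adiv (phi phi1 : R -> R) : annular a b phi -> annular a b phi1 ->
    annular a b (fun p => 4 * p * phi1 p + (n%:R - 2) * phi p).
  by move=> aphi aphi1; apply: annularD; [exact: (aM 1%N)|exact: aZ].
(* The squares in [int_Lu] and [int_rem1] differ by a cross term 64 Q p^3 f' f''; matching it with 4
   p psi' determines [psi]. *)
pose psi p := 8 * Q * p ^+ 2 * f1 p ^+ 2.
pose psi1 p := 8 * Q * (2 * p * f1 p ^+ 2 + p ^+ 2 * (2 * f1 p * f2 p)).
have dpsi (p : R) : is_derive p 1 psi (psi1 p).
  have d1 := df1 p; apply: is_derive_eq; rewrite /psi1 /GRing.scale/=; ring.
have apsi : annular a b psi by apply: aM; exact: annular_sqr.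
have apsi1 : annular a b psi1.
  apply: aZ; apply: annularD; first by apply: (aM 1%N); exact: annular_sqr.
  apply: annularM; first exact: exprn_continuous.
  by apply: annularM af2 => q; apply: cvgM; [exact: cvg_cst|exact: cf1].
(* 4 p chi' cancels the cross term 4 (Q - 4) p f f' of the square in [int_rem0]. *)
pose chi p := - (Q - 4) / 2 * f p ^+ 2.
pose chi1 p := - (Q - 4) * f p * f1 p.
have dchi (p : R) : is_derive p 1 chi (chi1 p).
  by have d1 := df p; apply: is_derive_eq; rewrite /chi1 /GRing.scale/=; field.
have achi : annular a b chi by apply: aZ; exact: annular_sqr.
have achi1 : annular a b chi1.
  apply: (annularM (psi := fun p => - (Q - 4) * f p)) af1 => q.
  apply: cvgM; first exact: cvg_cst.
  by have [cf _ _] := af; exact: cf.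
have Jpsi := radial_integral_div n a0 b0 apsi (let: And3 c _ _ := apsi1 in c) dpsi.
have Jchi := radial_integral_div n a0 b0 achi (let: And3 c _ _ := achi1 in c) dchi.
have agrad : annular a b (fun p => 16 * p ^+ 2 * f1 p ^+ 2).
  by apply: aM; exact: annular_sqr.
have afun : annular a b (fun p => f p ^+ 2) by exact: annular_sqr.
have arem0 : annular a b (fun p => 16 * (p * f1 p + (Q - 4) / 8 * f p) ^+ 2).
  apply: (aZ); apply: annular_sqr; apply: annularD; last exact: aZ.
  by apply: annularM af1 => p; exact: cvg_id.
have nE : n%:R = Q - 2 by rewrite /Q natrD addrK.
have n4 : (n + 4)%:R = Q + 2 by rewrite natrD nE; ring.
split.
- rewrite -(radial_integralZ n a0 b0 _ agrad).
  rewrite -(radial_integralD n a0 b0 (aZ _ _ agrad) (asq _ (alin _))).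
  have asum := annularD (aZ (Q ^+ 2 / 4) _ agrad) (asq _ (alin (2 * (Q + 4)))).
  (* The vanishing integral for [psi] is added on the right, after which the integrands agree
     pointwise. *)
  rewrite -[RHS]adde0 -Jpsi.
  rewrite -(radial_integralD n a0 b0 asum (adiv _ _ apsi apsi1)).
  congr radial_integral; apply/funext => p; rewrite /psi /psi1 nE n4.
  by field.
- rewrite -(radial_integralZ n a0 b0 _ afun) -(radial_integralZ n a0 b0 _ arem0).
  rewrite -(radial_integralD n a0 b0 (aZ _ _ afun) (aZ _ _ arem0)).
  have asum := annularD (aZ (Q ^+ 2 * (Q - 4) ^+ 2 / 16) _ afun) (aZ (Q ^+ 2 / 4) _ arem0).
  rewrite -(radial_integralD n a0 b0 asum (asq _ (alin _))).
  have asum1 := annularD asum (asq _ (alin (2 * (Q + 4)))).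
  have achidiv := adiv _ _ achi achi1.
  (* The vanishing integral for [chi] enters with factor Q^2 / 4, the coefficient of the gradient
     term in (a) that it resolves. *)
  rewrite -[RHS]adde0 -[X in (_ + X)%E](mule0 (Q ^+ 2 / 4)%:E) -Jchi.
  rewrite -(radial_integralZ n a0 b0 _ achidiv) -[RHS]adde0 -Jpsi.
  rewrite -(radial_integralD n a0 b0 asum1 (aZ _ _ achidiv)).
  have asum2 := annularD asum1 (aZ (Q ^+ 2 / 4) _ achidiv).
  rewrite -(radial_integralD n a0 b0 asum2 (adiv _ _ apsi apsi1)).
  congr radial_integral; apply/funext => p; rewrite /psi /psi1 /chi /chi1 nE n4.
  by field.
Qed.
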